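(* Let $t \ge 2$ and $n \ge 3t-3$ be integers. Then $$\mathrm{wsat}(K_n,K_{t,t}) = (t-1)\left(n+1-\frac{t}{2}\right).$$
   Context: All graphs are finite and simple; $K_n$ is the complete graph on $n$ vertices and $K_{a,b}$ is the complete bipartite graph with parts of sizes $a$ and $b$. A copy of a graph $H$ in a graph $G$ is a (not necessarily induced) subgraph of $G$ isomorphic to $H$. Let $F$ and $H$ be graphs. A spanning subgraph $G$ of $F$ is weakly $(F,H)$-saturated if $G$ contains no copy of $H$, but there is an ordering $e_1,\ldots,e_k$ of $E(F)\setminus E(G)$ such that for each $i\in\{1,\dots,k\}$ the graph $G\cup\{e_1,\ldots,e_i\}$ contains a copy $H'$ of $H$ with $e_i\in E(H')$. The weak saturation number $\mathrm{wsat}(F,H)$ is the minimum number of edges of a weakly $(F,H)$-saturated graph. *)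

(* Defs.v *)
From HB Require Import structures.
From mathcomp Require Import all_boot all_order all_algebra.

Set Implicit Arguments.
Unset Strict Implicit.
Unset Printing Implicit Defensive.

(* A simple graph on the finite vertex type V is given by its edge set, whose
   members are two-element sets of vertices. *)
Record sgraph (V : finType) := SGraph {
  edges : {set {set V}};
  edges_card2 : [forall e in edges, #|e| == 2] }.

HB.instance Definition _ (V : finType) := [isSub for @edges V].
HB.instance Definition _ (V : finType) := [Countable of sgraph V by <:].
HB.instance Definition _ (V : finType) := [Finite of sgraph V by <:].

Lemma sgraph_of_subproof (V : finType) (A : {set {set V}}) :
  [forall e in [set e in A | #|e| == 2], #|e| == 2].
Proof. by apply/forall_inP => e; rewrite inE => /andP[]. Qed.

(* The filter only makes sgraph_of total: below, A already consists of
   two-element sets, except for complete, where A is setT. *)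
Definition sgraph_of (V : finType) (A : {set {set V}}) : sgraph V :=
  SGraph (sgraph_of_subproof A).

Definition complete (n : nat) : sgraph 'I_n := sgraph_of [set: {set 'I_n}].

Definition complete_bipartite (a b : nat) : sgraph ('I_a + 'I_b)%type :=
  sgraph_of [set [set inl i; inr j] | i : 'I_a, j : 'I_b].

Section WeakSaturation.
Variables U V : finType.
Implicit Types (F G : sgraph V) (H : sgraph U) (f : {ffun U -> V}).

(* Copies are not necessarily induced. A copy is represented by an injection f
   of the vertices of H whose image is the copy; copy_edges is the edge set of
   that image. *)
Definition copy_edges H f : {set {set V}} := [set f @: e | e : {set U} in edges H].

Definition is_copy H G f : bool := injectiveb f && (copy_edges H f \subset edges G).

Definition contains_copy H G : bool := [exists f, is_copy H G f].

Definition contains_copy_through H G (e : {set V}) : bool :=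
  [exists f, is_copy H G f && (e \in copy_edges H f)].

Definition add_edges G (s : seq {set V}) : sgraph V :=
  sgraph_of (edges G :|: [set:: s]).

(* With edges indexed from 0, the graph obtained right after adding tnth s i is
   add_edges G (take i.+1 s). *)
Definition saturating_order F H G k (s : k.-tuple {set V}) : bool :=
  [&& uniq s, [set:: s] == edges F :\: edges G
    & [forall i : 'I_k,
        contains_copy_through H (add_edges G (take i.+1 s)) (tnth s i)]].

Definition weakly_saturated F H G : bool :=
  [&& edges G \subset edges F, ~~ contains_copy H G
    & [exists s : #|edges F :\: edges G|.-tuple {set V},
        saturating_order F H G s]].

(* The default value #|edges F| bounds all the terms, so it does not affect the
   minimum when a weakly (F, H)-saturated graph exists; wsatP shows that one
   exists as soon as H has an edge. *)
Definition wsat F H : nat :=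
  \big[minn/#|edges F|]_(G : sgraph V | weakly_saturated F H G) #|edges G|.

Lemma edges_sgraph_of (A : {set {set V}}) F :
  A \subset edges F -> edges (sgraph_of A) = A.
Proof.
move=> /subsetP sAF; apply/setP => e; rewrite inE andb_idr // => /sAF eF.
exact: (forall_inP (edges_card2 F)).
Qed.

Lemma wsat_exists F H : edges H != set0 -> exists G, weakly_saturated F H G.
Proof.
case/set0Pn => e0 e0H.
pose reach G s := [/\ edges G \subset edges F, uniq s,
  [set:: s] = edges F :\: edges G &
  forall i, i < size s ->
    contains_copy_through H (add_edges G (take i.+1 s)) (nth set0 s i)].
suff main m G s : #|edges G| <= m -> reach G s -> exists G', weakly_saturated F H G'.
  apply: (main #|edges F| F [::]) => //; split=> //.
  by apply/setP => e; rewrite !inE andNb.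
elim: m G s => [|m IHm] G s leGm [sGF us sE sP].
all: have [/existsP[f cf]|nc] := boolP (contains_copy H G); last first.
1,3: exists G; rewrite /weakly_saturated sGF nc /=.
1,2: have sz : size s == #|edges F :\: edges G|
       by rewrite -sE; apply/eqP; rewrite cardsE -(card_uniqP us).
1,2: apply/existsP; exists (Tuple sz); rewrite /saturating_order us sE eqxx /=.
1,2: by apply/forallP => i; rewrite (tnth_nth set0) /=; apply: sP;
        rewrite (eqP sz).
all: have eG : f @: e0 \in edges G
       by case/andP: cf => _ /subsetP; apply; apply: imset_f.
  by move: leGm; rewrite leqn0 cards_eq0 => /eqP G0; rewrite G0 inE in eG.
set e := f @: e0 in eG *.
have sG' : edges G :\ e \subset edges F by apply: subset_trans sGF; apply: subD1set.
pose G' := sgraph_of (edges G :\ e).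
have EG' : edges G' = edges G :\ e by apply: edges_sgraph_of sG'.
have addE r : add_edges G' (e :: r) = add_edges G r.
  rewrite /add_edges EG'; congr sgraph_of; apply/setP => x.
  by rewrite !inE; case: (eqVneq x e) => [->|//]; rewrite eG.
apply: (IHm G' (e :: s)); first by move: leGm; rewrite EG' (cardsD1 e) eG.
split=> [|||[_|i lti]]; rewrite ?EG' //.
- rewrite /= us andbT; apply/negP => es.
  by have : e \in [set:: s]; [rewrite inE | rewrite sE !inE eG].
- apply/setP => x; have /setP/(_ x) := sE; rewrite !inE => ->.
  by case: (eqVneq x e) => [->|//]; rewrite (subsetP sGF).
- rewrite /= take0 addE; apply/existsP; exists f; rewrite imset_f // andbT.
  case/andP: cf => injf sfG; rewrite /is_copy injf /=.
  apply: subset_trans sfG _; apply/subsetP => x xG.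
  by rewrite !inE xG (forall_inP (edges_card2 G)).
- by rewrite /= addE; apply: sP.
Qed.

Lemma wsatP F H : edges H != set0 ->
  (exists2 G, weakly_saturated F H G & #|edges G| = wsat F H) /\
  (forall G, weakly_saturated F H G -> wsat F H <= #|edges G|).
Proof.
move=> /(wsat_exists F)[G0 wG0].
have lbF G : weakly_saturated F H G -> wsat F H <= #|edges G|.
  rewrite /wsat => wG; have := mem_index_enum G.
  elim: (index_enum _) => [//|x r IHr]; rewrite inE big_cons.
  case/predU1P => [<-|/IHr le]; first by rewrite wG geq_minl.
  by case: ifP => // _; apply: leq_trans (geq_minr _ _) le.
split=> //.
have : wsat F H = #|edges F| \/
       exists2 G, weakly_saturated F H G & #|edges G| = wsat F H.
  rewrite /wsat; elim/big_rec: _ => [|G x wG [IH|[G' wG' IH]]]; first by left.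
    right; exists G => //; apply/esym/minn_idPl; rewrite IH.
    by apply: subset_leq_card; case/and3P: wG.
  right; have [le|lt] := leqP #|edges G| x; first by exists G.
  by exists G'.
case=> // wF; exists G0 => //; apply/eqP; rewrite eqn_leq lbF // wF andbT.
by apply: subset_leq_card; case/and3P: wG0.
Qed.

End WeakSaturation.

(* Main.v *)
(* Put d = t - 1, so that the claim reads wsat + C(d, 2) = d n.

   Lower bound: give the vertices distinct rational nodes x_v, and to every
   vertex u attach a polynomial M_u of degree < d.  Call an edge uv good if
   M_u(x_v) + M_v(x_u) = 0.  Divided differences over the two parts of a copy of
   K_{t,t} give a linear relation, with nonzero coefficients, between these sums
   over its edges: if all edges but one are good, so is the last.  If a
   weakly saturated graph had fewer than d n - C(d, 2) edges, linear algebra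
   would give some M <> 0 for which its edges are good and which moreover
   satisfies M_u(x_v) = 0 for u < v in a fixed set of d vertices.  Then all edges
   are good, and interpolation forces M = 0.

   Upper bound: join a set X of d vertices to its complement Y, and add a
   K_{d+1} inside Y.  A vertex of Y with d neighbours in Y becomes adjacent to
   all of Y, which completes first Y, then X.  By the lower bound this graph
   cannot lose an edge of a copy of K_{t,t}, so it contains no such copy. *)

Require Import Defs.
From HB Require Import structures.
From mathcomp Require Import all_boot all_order all_algebra.
From mathcomp Require Import ring zify.
Import GRing.Theory.
Local Open Scope ring_scope.

Set Implicit Arguments.
Unset Strict Implicit.
Unset Printing Implicit Defensive.

(** * Weak saturation as percolation *)

Section Percolation.
Local Open Scope nat_scope.
Variables (U V : finType) (F : sgraph V) (H : sgraph U).
Implicit Types (A E : {set {set V}}) (G : sgraph V) (e : {set V}).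

(** Closed sets replace orderings: a lower bound needs one well-chosen closed set, an upper bound
    derives memberships in an arbitrary one. [E] may contain sets that are not pairs; [sgraph_of]
    discards them. *)
Definition sat_closed E : bool :=
  [forall e in edges F,
    contains_copy_through H (sgraph_of (e |: E)) e ==> (e \in E)].

(* Weak saturation without the requirement that A contain no copy of H, see
   weakly_saturated_percolates and percolates_weakly_saturated. *)
Definition percolates A : Prop :=
  forall E, sat_closed E -> A \subset E -> edges F \subset E.

Lemma edges_card G e : e \in edges G -> #|e| = 2.
Proof. by move=> eG; apply/eqP; apply: (forall_inP (edges_card2 G)). Qed.

Lemma in_sgraph_of A e : (e \in edges (sgraph_of A)) = (e \in A) && (#|e| == 2).
Proof. by rewrite inE. Qed.

Lemma copy_through_sub G (G' : sgraph V) e :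
  edges G \subset edges G' ->
  contains_copy_through H G e -> contains_copy_through H G' e.
Proof.
move=> sGG' /existsP[f /andP[/andP[injf sf] ef]]; apply/existsP; exists f.
by rewrite /is_copy injf ef (subset_trans sf sGG').
Qed.

Lemma sat_closedP E G e :
    sat_closed E -> e \in edges F -> contains_copy_through H G e ->
  edges G :\ e \subset E -> e \in E.
Proof.
move=> /forall_inP clE eF cG sGE; apply: (implyP (clE e eF)).
apply: copy_through_sub cG; apply/subsetP => x xG.
rewrite in_sgraph_of (edges_card xG) eqxx andbT in_setU1.
by case: eqVneq => //= xe; apply: (subsetP sGE); rewrite in_setD1 xe.
Qed.

Lemma weakly_saturated_percolates G :
  weakly_saturated F H G -> percolates (edges G).
Proof.
case/and3P=> sGF _ /existsP[s /and3P[us /eqP sE /forallP thru]] E clE sGE.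
have nthF i : i < size s -> nth set0 s i \in edges F.
  move=> lti; have : nth set0 s i \in [set:: s] by rewrite inE mem_nth.
  by rewrite sE => /setDP[].
have nthE i : i < size s -> nth set0 s i \in E.
  elim/ltn_ind: i => i IH lti; have lti' := lti; rewrite size_tuple in lti'.
  have := thru (Ordinal lti'); rewrite (tnth_nth set0) /= => cG.
  apply: sat_closedP clE (nthF i lti) cG _.
  (* The prefix of length [i.+1] ends with the edge being added; [xe] excludes it, and the induction
     hypothesis covers the earlier ones. *)
  apply/subsetP => x; rewrite in_setD1 in_sgraph_of in_setU.
  case/andP=> xe /andP[/orP[/(subsetP sGE)//|xs] _].
  move: xs; rewrite inE => /(nthP set0)[j ltj xj].
  move: ltj xj; rewrite size_takel // ltnS => leji; rewrite nth_take // => xj.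
  move: leji; rewrite leq_eqVlt => /predU1P[ji|ltji].
    by rewrite -xj ji eqxx in xe.
  by rewrite -xj IH // (ltn_trans ltji).
apply/subsetP => x xF; case: (boolP (x \in edges G)) => [/(subsetP sGE)//|xG].
have : x \in [set:: s] by rewrite sE inE xG.
by rewrite inE => /(nthP set0)[i lti <-]; apply: nthE.
Qed.

(** The ordering is built greedily: while edges are missing, the current graph is not closed, so
    some missing edge completes a copy. *)
Lemma percolates_weakly_saturated G :
    edges G \subset edges F -> ~~ contains_copy H G -> percolates (edges G) ->
  weakly_saturated F H G.
Proof.
move=> sGF ncG percG; rewrite /weakly_saturated sGF ncG /=.
set D := edges F :\: edges G.
suff main k : k <= #|D| -> exists s : seq {set V},
    [/\ size s = k, uniq s, {subset s <= D} & forall i, i < size s ->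
      contains_copy_through H (add_edges G (take i.+1 s)) (nth set0 s i)].
  have [s [sz us sD thru]] := main _ (leqnn _).
  apply/existsP; exists (Tuple (introT eqP sz)); rewrite /saturating_order us /=.
  apply/andP; split; last first.
    by apply/forallP => i; rewrite (tnth_nth set0) /= thru // sz.
  rewrite eqEcard; apply/andP; split.
    by apply/subsetP => x; rewrite inE => /sD.
  by rewrite -/D -sz cardsE (card_uniqP us).
elim: k => [_|k IHk ltk]; first by exists [::].
have [s [sz us sD thru]] := IHk (ltnW ltk).
pose E := edges G :|: [set:: s].
have EF : E \subset edges F.
  apply/subUsetP; split=> //; apply/subsetP => x; rewrite inE => /sD.
  by case/setDP.
have : ~~ sat_closed E.
  apply/negP => /percG/(_ (subsetUl _ _)) sFE.
  suff : #|D| <= k by rewrite leqNgt ltk.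
  rewrite -sz -(card_uniqP us); apply: subset_leq_card; apply/subsetP => x.
  by case/setDP=> /(subsetP sFE); rewrite !inE => /orP[->|].
rewrite negb_forall_in => /exists_inP[e eF]; rewrite negb_imply => /andP[ce eE].
have [eG es] : e \notin edges G /\ e \notin s.
  by apply/norP; rewrite !inE in eE.
exists (rcons s e); split=> [|||i].
- by rewrite size_rcons sz.
- by rewrite rcons_uniq es.
- by move=> x; rewrite mem_rcons inE => /predU1P[->|/sD//]; rewrite !inE eG.
rewrite size_rcons ltnS leq_eqVlt nth_rcons -cats1 take_cat.
case/predU1P=> [->|lti].
  rewrite ltnn eqxx ltnNge leqnSn /= subSn // subnn /=.
  apply: copy_through_sub ce; apply/subsetP => x; rewrite !in_sgraph_of.
  case/andP=> xE ->; rewrite andbT; move: xE; rewrite !inE mem_cat inE.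
  by case/or3P=> ->; rewrite ?orbT.
rewrite lti -/(take i.+1 s); have := thru i lti.
case: ltnP => // le; rewrite (take_oversize le).
have -> : i.+1 - size s = 0 by apply/eqP; rewrite subn_eq0.
by rewrite take0 cats0.
Qed.

(** The other edges of the copy lie in [A :\ e], so every closed set containing them recovers
    [e]. *)
Lemma percolates_del A e (f : {ffun U -> V}) :
    A \subset edges F -> percolates A -> is_copy H (sgraph_of A) f ->
    e \in copy_edges H f ->
  percolates (A :\ e).
Proof.
move=> sAF percA cf ef E clE sAE; apply: percA => //.
have sA : edges (sgraph_of A) = A by apply: edges_sgraph_of sAF.
have eA : e \in A by case/andP: (cf) => _ /subsetP/(_ _ ef); rewrite sA.
rewrite -(setD1K eA) subUset sAE andbT sub1set.
apply: (@sat_closedP _ (sgraph_of A)) => //; first exact: (subsetP sAF).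
  by apply/existsP; exists f; rewrite cf.
by rewrite sA.
Qed.

(** A percolating set of minimum size contains no copy of [H]: by [percolates_del] an edge of a copy
    could be deleted. *)
Lemma wsat_eq A :
    edges H != set0 -> A \subset edges F -> percolates A ->
    (forall B : {set {set V}}, B \subset edges F -> percolates B -> #|A| <= #|B|) ->
  wsat F H = #|A|.
Proof.
move=> H0 sAF percA minA; have [[G wG eG] lbW] := wsatP F H0.
have sA : edges (sgraph_of A) = A by apply: edges_sgraph_of sAF.
apply/eqP; rewrite eqn_leq -{2}eG minA ?andbT; last 2 first.
- by case/and3P: wG.
- exact: weakly_saturated_percolates.
rewrite -[in leqRHS]sA; apply: lbW.
apply: percolates_weakly_saturated; rewrite ?sA //.
apply/negP => /existsP[f cf]; case/set0Pn: H0 => e0 e0H.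
have ef : f @: e0 \in copy_edges H f by apply: imset_f.
have eA : f @: e0 \in A by case/andP: (cf) => _ /subsetP/(_ _ ef); rewrite sA.
have := minA _ (subset_trans (subD1set _ _) sAF) (percolates_del sAF percA cf ef).
by rewrite (cardsD1 (f @: e0) A) eA ltnn.
Qed.

End Percolation.

(** * Copies of complete bipartite graphs as pairs of disjoint vertex sets *)

Section BipartiteCopies.
Local Open Scope nat_scope.
Variable V : finType.
Implicit Types (P Q : {set V}) (G : sgraph V) (e : {set V}).

Lemma imset_set2 (T : finType) (f : T -> V) (a b : T) :
  f @: [set a; b] = [set f a; f b].
Proof. by rewrite imsetU !imset_set1. Qed.

Lemma edges_complete_bipartite a b (e : {set 'I_a + 'I_b}) :
  (e \in edges (complete_bipartite a b)) =
  (e \in [set [set inl i; inr j] | i : 'I_a, j : 'I_b]).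
Proof. by rewrite in_sgraph_of andb_idr // => /imset2P[i j _ _ ->]; rewrite cards2. Qed.

Lemma complete_bipartite_throughP a b G e :
  contains_copy_through (complete_bipartite a b) G e <->
  exists P Q p q, [/\ #|P| = a /\ #|Q| = b, [disjoint P & Q], p \in P /\ q \in Q,
    e = [set p; q] & forall p' q', p' \in P -> q' \in Q -> [set p'; q'] \in edges G].
Proof.
split=> [|[P [Q [p [q [[cP cQ] dPQ [pP qQ] -> PQ]]]]]].
  case/existsP=> f /andP[/andP[/injectiveP injf sfG] /imsetP[e0 e0H ->]].
  have /imset2P[i j _ _ e0E] := etrans (esym (edges_complete_bipartite _)) e0H.
  exists [set f (inl i) | i : 'I_a], [set f (inr j) | j : 'I_b], (f (inl i)), (f (inr j)).
  split.
  - by rewrite !card_imset ?card_ord // => x y /injf[].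
  - by rewrite -setI_eq0; apply/eqP/setP => x; rewrite !inE; apply/negP;
      case/andP=> /imsetP[k _ ->] /imsetP[l _ /injf].
  - by split; apply: imset_f.
  - by rewrite e0E imset_set2.
  move=> _ _ /imsetP[k _ ->] /imsetP[l _ ->]; rewrite -imset_set2.
  apply: (subsetP sfG); apply: imset_f; rewrite edges_complete_bipartite.
  exact: imset2_f.
pose f : {ffun 'I_a + 'I_b -> V} := [ffun x => match x with
  | inl i => enum_val (cast_ord (esym cP) i)
  | inr j => enum_val (cast_ord (esym cQ) j) end].
have fl i : f (inl i) \in P by rewrite ffunE enum_valP.
have fr j : f (inr j) \in Q by rewrite ffunE enum_valP.
have injf : injective f.
  move=> [i|i] [j|j].
  - by rewrite !ffunE => /enum_val_inj/cast_ord_inj->.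
  - by move=> fij; have := disjointFr dPQ (fl i); rewrite fij fr.
  - by move=> fij; have := disjointFr dPQ (fl j); rewrite -fij fr.
  - by rewrite !ffunE => /enum_val_inj/cast_ord_inj->.
apply/existsP; exists f; rewrite /is_copy; apply/andP; split.
  apply/andP; split; first exact/injectiveP.
  apply/subsetP => _ /imsetP[e0 e0H ->]; move: e0H; rewrite edges_complete_bipartite.
  by case/imset2P=> i j _ _ ->; rewrite imset_set2 PQ.
apply/imsetP; exists [set inl (cast_ord cP (enum_rank_in pP p));
                      inr (cast_ord cQ (enum_rank_in qQ q))].
  by rewrite edges_complete_bipartite; apply: imset2_f.
by rewrite imset_set2 !ffunE !cast_ordK !enum_rankK_in.
Qed.

End BipartiteCopies.

(** * Interpolation and linear algebra *)

Lemma card_subset_exists (T : finType) (k : nat) (S : {set T}) :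
  (k <= #|S|)%N -> exists2 B : {set T}, B \subset S & #|B| = k.
Proof.
rewrite -bin_gt0 -cards_draws => /card_gt0P[B].
by rewrite inE => /andP[sBS /eqP cB]; exists B.
Qed.

(** The sum is the coefficient of degree [#|S|.-1] in the Lagrange interpolant of [p] at the nodes
    of [S], which is [p] itself. *)
Lemma divided_difference (F : fieldType) (T : finType) (x : T -> F) (S : {set T}) :
    injective x ->
  exists2 w : T -> F, forall a, a \in S -> w a != 0 &
    forall p : {poly F}, (size p < #|S|)%N -> \sum_(a in S) w a * p.[x a] = 0.
Proof.
move=> injx; pose Q a := \prod_(b in S :\ a) ('X - (x b)%:P).
have Q_neq0 a : (Q a).[x a] != 0.
  rewrite horner_prod; apply/prodf_neq0 => b; rewrite !inE => /andP[ba _].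
  by rewrite hornerXsubC subr_eq0 (inj_eq injx) eq_sym.
have Q_eq0 a b : b \in S -> b != a -> (Q a).[x b] = 0.
  move=> bS ba; rewrite horner_prod (bigD1 b) ?inE ?ba //=.
  by rewrite hornerXsubC subrr mul0r.
have size_Q a : a \in S -> size (Q a) = #|S|.
  by move=> aS; rewrite /Q -big_enum size_prod_XsubC -cardE (cardsD1 a S) aS.
exists (fun a => (Q a).[x a]^-1) => [a _|p ltp]; first by rewrite invr_neq0.
have S_gt0 : (0 < #|S|)%N by apply: leq_ltn_trans ltp.
pose r := \sum_(a in S) ((Q a).[x a]^-1 * p.[x a]) *: Q a.
have rp : r = p.
  apply/eqP; rewrite -subr_eq0; apply/negP => /negP rp0.
  (* [r - p] vanishes at all [#|S|] nodes but has size at most [#|S|]. *)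
  have := max_poly_roots rp0 (rs := [seq x a | a <- enum S]).
  rewrite map_inj_uniq ?enum_uniq // size_map -cardE => /(_ _ isT) lt.
  have {lt}/lt : all (root (r - p)) [seq x a | a <- enum S].
    apply/allP => _ /mapP[b + ->]; rewrite mem_enum => bS.
    rewrite rootE hornerD hornerN horner_sum (bigD1 b) //= big1 => [|a /andP[_ ab]].
      by rewrite hornerZ mulrAC mulVf // mul1r addr0 subrr.
    by rewrite hornerZ (@Q_eq0 a b) ?mulr0 // eq_sym.
  apply/negP; rewrite -leqNgt (leq_trans (size_polyD _ _)) // geq_max size_polyN.
  rewrite (ltnW ltp) andbT (leq_trans (size_sum _ _ _)) //.
  apply/bigmax_leqP => a aS; rewrite (leq_trans (size_scale_leq _ _)) //.
  by rewrite size_Q.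
have : r`_#|S|.-1 = 0 by rewrite rp nth_default // -ltnS prednK.
rewrite coef_sum => r0; rewrite -[RHS]r0; apply: eq_bigr => a aS; rewrite coefZ -(size_Q a aS).
have /monicP := monic_prod_XsubC (index_enum T) (mem (S :\ a)) x.
by rewrite lead_coefE => ->; rewrite mulr1.
Qed.

(** The divided difference over [u |: B] is solved for the term at [u]. *)
Lemma interpolation (F : fieldType) (T : finType) (x : T -> F) (B : {set T}) (u : T) :
    injective x -> u \notin B ->
  exists w : T -> F, forall p : {poly F}, (size p <= #|B|)%N ->
    p.[x u] = \sum_(b in B) w b * p.[x b].
Proof.
move=> injx uB; have [w w0 sw] := divided_difference (u |: B) injx.
have wu := w0 u (setU11 _ _).
exists (fun b => - (w u)^-1 * w b) => p lep.
have := sw p; rewrite cardsU1 uB big_setU1 //= ltnS => /(_ lep)/eqP.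
rewrite addr_eq0 => /eqP/(canRL (mulKf wu)) ->.
by rewrite mulrN -mulNr big_distrr /=; apply: eq_bigr => b _; rewrite mulrA.
Qed.
(** By rank-nullity, each functional lowers the dimension by at most one. *)
Lemma common_kernel (F : fieldType) (vT : vectType F) (fs : seq 'Hom(vT, F^o)) :
  (size fs < dim vT)%N -> exists2 v : vT, v != 0 & forall f, f \in fs -> f v = 0.
Proof.
move=> ltfs.
have [U Ufs leU] : exists2 U : {vspace vT},
    forall f, f \in fs -> (U <= lker f)%VS & (dim vT <= \dim U + size fs)%N.
  elim: fs {ltfs} => [|f fs [U IHU leU]].
    by exists fullv; rewrite // dimvf addn0.
  exists (U :&: lker f)%VS => [g|].
    rewrite inE => /predU1P[->|/IHU]; first exact: capvSr.
    exact/subv_trans/capvSl.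
  rewrite (leq_trans leU) // -(limg_ker_dim f U) /= -addnA leq_add2l.
  rewrite addnC -[in leqRHS]addn1 leq_add2l.
  by rewrite (leq_trans (dimvS (subvf _))) ?dimvf.
exists (vpick U) => [|f /Ufs/subvP/(_ _ (memv_pick U))]; last first.
  by rewrite memv_ker => /eqP.
rewrite vpick0 -dimv_eq0 -lt0n.
by have := leq_trans ltfs leU; rewrite -[X in (X < _)%N]add0n ltn_add2r.
Qed.

(** * Lower bound by linear algebra *)

Section LowerBound.
Variables (n d : nat) (x : 'I_n -> rat).
Hypothesis injx : injective x.
Implicit Types (M : 'M[rat]_(n, d)) (u v : 'I_n).

(** The polynomial M_u, with row [u] of [M] as its coefficients. *)
Definition row_poly M u : {poly rat} := rVpoly (row u M).

Lemma size_row_poly M u : (size (row_poly M u) <= d)%N.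
Proof. exact: size_poly. Qed.

Lemma row_poly_eq0 M u (D : {set 'I_n}) :
  #|D| = d -> (forall v, v \in D -> (row_poly M u).[x v] = 0) -> row_poly M u = 0.
Proof.
move=> cD root0; apply/eqP; apply: contraT => nz.
have := max_poly_roots nz (rs := [seq x v | v <- enum D]).
rewrite map_inj_uniq ?enum_uniq // size_map -cardE cD ltnNge size_row_poly.
move=> /(_ _ isT) /= roots; apply: roots.
by apply/allP => _ /mapP[v + ->]; rewrite mem_enum => /root0/eqP.
Qed.

Definition row_eval u v M : rat^o := (row_poly M u).[x v].

Fact row_eval_linear u v : linear (row_eval u v).
Proof. by move=> a M N; rewrite /row_eval /row_poly !linearP hornerD hornerZ. Qed.
HB.instance Definition _ u v :=
  GRing.isLinear.Build rat 'M[rat]_(n, d) rat^o *:%R (row_eval u v)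
    (row_eval_linear u v).

(** Summing over both orders of the endpoints gives a form on unordered pairs; [upper_form] keeps
    only the increasing order. *)
Definition edge_form (e : {set 'I_n}) : 'Hom('M[rat]_(n, d), rat^o) :=
  \sum_(u in e) \sum_(v in e | v != u) linfun (row_eval u v).

Definition upper_form (e : {set 'I_n}) : 'Hom('M[rat]_(n, d), rat^o) :=
  \sum_(u in e) \sum_(v in e | (u < v)%N) linfun (row_eval u v).

Lemma edge_formE M u v :
  u != v -> edge_form [set u; v] M = row_eval u v M + row_eval v u M.
Proof.
move=> uv; have vu : v != u by rewrite eq_sym.
rewrite /edge_form sum_lfunE big_setU1 ?inE // big_set1.
rewrite (big_pred1 v) => [|w]; last first.
  by rewrite !inE; case: (eqVneq w u) => [->|]; rewrite ?(negPf uv) ?andbT.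
rewrite (big_pred1 u) => [|w]; last first.
  by rewrite !inE; case: (eqVneq w v) => [->|]; rewrite ?(negPf vu) ?andbF ?orbF ?andbT.
by rewrite !lfunE.
Qed.

Lemma upper_formE M u v : (u < v)%N -> upper_form [set u; v] M = row_eval u v M.
Proof.
move=> ltuv; have uv : u != v by rewrite -val_eqE neq_ltn ltuv.
rewrite /upper_form sum_lfunE big_setU1 ?inE // big_set1.
rewrite (big_pred1 v) => [|w]; last first.
  rewrite !inE; case: (eqVneq w u) => [->|_]; first by rewrite ltnn (negPf uv).
  by case: (eqVneq w v) => [->|_]; rewrite ?ltuv.
rewrite big_pred0 => [|w]; first by rewrite !lfunE /= addr0.
rewrite !inE; case: (eqVneq w u) => [->|_]; first by rewrite ltnNge ltnW.
by case: (eqVneq w v) => [->|_]; rewrite ?ltnn.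
Qed.

Lemma edge_form_closed M :
  sat_closed (complete n) (complete_bipartite d.+1 d.+1)
    [set e | edge_form e M == 0].
Proof.
apply/forall_inP => e _; apply/implyP => /complete_bipartite_throughP.
case=> P [Q] [p] [q] [[cP cQ] dPQ [pP qQ] eE PQ].
have neqPQ u v : u \in P -> v \in Q -> u != v.
  by move=> uP; apply: contraTneq => <-; rewrite (disjointFr dPQ uP).
(* As [P] and [Q] are disjoint, no other pair of [P] and [Q] yields the edge [e]. *)
have forms0 u v : u \in P -> v \in Q -> (u, v) != (p, q) ->
    row_eval u v M + row_eval v u M = 0.
  move=> uP vQ uvpq; rewrite -edge_formE ?neqPQ //.
  have := PQ u v uP vQ; rewrite in_sgraph_of => /andP[+ _].
  rewrite in_setU1 inE => /predU1P[|/eqP//]; rewrite eE => /setP uv_pq.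
  have := uv_pq u; rewrite !inE eqxx (negPf (neqPQ _ _ uP qQ)) orbF => /esym/eqP up.
  have := uv_pq v; rewrite !inE eqxx orbT (eq_sym v p) (negPf (neqPQ _ _ pP vQ)).
  by move=> /esym/eqP vq; rewrite up vq eqxx in uvpq.
have [a a0 sa] := divided_difference P injx.
have [b b0 sb] := divided_difference Q injx.
(* For fixed [u], the first summands form a divided difference of M_u over the [d.+1] nodes of [Q],
   hence cancel; for fixed [v], the second ones do so over [P]. *)
have : \sum_(u in P) \sum_(v in Q)
    a u * b v * (row_eval u v M + row_eval v u M) = 0.
  under eq_bigr => u _ do (under eq_bigr => v _ do rewrite mulrDr; rewrite big_split /=).
  rewrite big_split /= [X in _ + X]exchange_big /= !big1 ?addr0 // => [v|u] _.
    under eq_bigr => u _ do rewrite mulrAC mulrC.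
    by rewrite -big_distrr /= sa ?mulr0 // cP ltnS size_row_poly.
  under eq_bigr => v _ do rewrite -mulrA.
  by rewrite -big_distrr /= sb ?mulr0 // cQ ltnS size_row_poly.
rewrite (bigD1 p) //= (bigD1 q) //= !big1 ?addr0.
- move/eqP; rewrite -mulrA !mulf_eq0 (negPf (a0 _ pP)) (negPf (b0 _ qQ)) /=.
  by rewrite inE eE edge_formE // neqPQ.
- move=> u /andP[uP up]; apply: big1 => v vQ; rewrite forms0 ?mulr0 //.
  by rewrite xpair_eqE (negPf up).
move=> v /andP[vQ vq]; rewrite forms0 ?mulr0 //.
by rewrite xpair_eqE (negPf vq) andbF.
Qed.

(* Interpolating at x_u from the nodes of two disjoint sets B and C of d vertices
   gives M_u(x_u) = - sum_b sum_c w_b w'_c M_b(x_c); exchanging the roles of B and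
   C, and M_b(x_c) = - M_c(x_b), turn this into M_u(x_u) = - M_u(x_u). *)
Lemma antisymmetric_diag M :
    (2 * d < n)%N -> (forall u v, u != v -> row_eval u v M = - row_eval v u M) ->
  forall u, row_eval u u M = 0.
Proof.
move=> ltdn anti u.
have cu : #|~: [set u]| = n.-1 by rewrite cardsC1 card_ord.
have [|B sB cB] := @card_subset_exists _ d (~: [set u]); first by rewrite cu; lia.
have [|C sC cC] := @card_subset_exists _ d (~: [set u] :\: B).
  by rewrite cardsDS // cu cB; lia.
have uB b : b \in B -> u != b.
  by move/(subsetP sB); rewrite !inE eq_sym.
have uC c : c \in C -> u != c.
  by move/(subsetP sC); rewrite !inE eq_sym => /andP[].
have BC b c : b \in B -> c \in C -> b != c.
  by move=> bB /(subsetP sC); rewrite !inE => /andP[+ _]; apply: contraNneq => <-.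
have [w wE] := @interpolation _ _ x B u injx (contraL (@uB u) (eqxx u)).
have [w' w'E] := @interpolation _ _ x C u injx (contraL (@uC u) (eqxx u)).
have evB v : row_eval v u M = \sum_(b in B) w b * row_eval v b M.
  by rewrite /row_eval wE // cB size_row_poly.
have evC v : row_eval v u M = \sum_(c in C) w' c * row_eval v c M.
  by rewrite /row_eval w'E // cC size_row_poly.
suff : row_eval u u M = - row_eval u u M.
  by move/esym/eqP; rewrite Num.Theory.eqNr => /eqP.
rewrite {1}evB.
under eq_bigr => b bB do rewrite anti ?uB // evC mulrN big_distrr /=.
rewrite sumrN exchange_big evC; congr (- _); apply: eq_bigr => c cC'.
rewrite anti ?uC // evB mulrN big_distrr /= -sumrN; apply: eq_bigr => b bB.
by rewrite anti ?BC // !mulrN mulrCA.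
Qed.

Lemma percolates_lower_bound (A : {set {set 'I_n}}) :
    (2 * d < n)%N ->
    percolates (complete n) (complete_bipartite d.+1 d.+1) A ->
  (d * n <= #|A| + 'C(d, 2))%N.
Proof.
move=> ltdn percA; rewrite leqNgt; apply/negP => lt.
have [|D _ cD] := @card_subset_exists _ d [set: 'I_n].
  by rewrite cardsT card_ord; lia.
pose pairs := [set e : {set 'I_n} | e \subset D & #|e| == 2].
pose fs := [seq edge_form e | e <- enum A] ++ [seq upper_form e | e <- enum pairs].
(* There are [#|A| + 'C(d, 2)] forms on a space of dimension [d * n]. *)
have [|M M0 fsM] := @common_kernel _ _ fs.
  by rewrite size_cat !size_map -!cardE cards_draws cD dim_matrix mulrC.
have edge0 u v : u != v -> row_eval u v M + row_eval v u M = 0.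
  move=> uv; rewrite -edge_formE //; apply/eqP.
  have : [set u; v] \in edges (complete n) by rewrite in_sgraph_of inE cards2 uv.
  have sA : A \subset [set e | edge_form e M == 0].
    apply/subsetP => e eA; rewrite inE fsM // mem_cat map_f //.
    by rewrite mem_enum.
  by move/(subsetP (percA _ (edge_form_closed M) sA)); rewrite inE.
have anti u v : u != v -> row_eval u v M = - row_eval v u M.
  by move=> uv; apply/eqP; rewrite -addr_eq0 edge0.
have upper0 u v : u \in D -> v \in D -> (u < v)%N -> row_eval u v M = 0.
  move=> uD vD ltuv; rewrite -upper_formE // fsM // mem_cat; apply/orP; right.
  apply: map_f; rewrite mem_enum inE cards2 -val_eqE neq_ltn ltuv andbT.
  by apply/subsetP => w; rewrite !inE => /orP[] /eqP->.
(* M_u vanishes at all [d] nodes of [D]: above [u] by the upper forms, below by antisymmetry, at [u]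
   by [antisymmetric_diag]. *)
have D0 u : u \in D -> row_poly M u = 0.
  move=> uD; apply: row_poly_eq0 cD _ => v vD.
  case: (ltngtP u v) => [ltuv|ltvu|/val_inj->].
  - exact: upper0.
  - by rewrite [LHS]anti ?upper0 ?oppr0 // -val_eqE neq_ltn ltvu orbT.
  exact: antisymmetric_diag.
(* For [u] outside [D], antisymmetry transfers the vanishing of the rows in [D] to the values of M_u
   on [D]. *)
have all0 u : row_poly M u = 0.
  have [/D0//|uD] := boolP (u \in D).
  apply: row_poly_eq0 cD _ => v vD; rewrite [LHS]anti.
    by rewrite /row_eval D0 // horner0 oppr0.
  by apply: contraNneq uD => ->.
case/eqP: M0; apply/row_matrixP => u; rewrite row0.
by apply: (can_inj rVpolyK); rewrite [LHS]all0 linear0.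
Qed.

End LowerBound.

(** * Upper bound by construction *)

Section UpperBound.
Variables n d : nat.
Hypothesis hn : (3 * d <= n)%N.
Implicit Types (E : {set {set 'I_n}}) (N P Q : {set 'I_n}).

Lemma sat_closed_edge E P Q p q :
    sat_closed (complete n) (complete_bipartite d.+1 d.+1) E ->
    #|P| = d.+1 -> #|Q| = d.+1 -> [disjoint P & Q] -> p \in P -> q \in Q ->
    (forall p' q', p' \in P -> q' \in Q -> (p', q') != (p, q) -> [set p'; q'] \in E) ->
  [set p; q] \in E.
Proof.
move=> clE cP cQ dPQ pP qQ PQ.
have neqPQ u v : u \in P -> v \in Q -> u != v.
  by move=> uP; apply: contraTneq => <-; rewrite (disjointFr dPQ uP).
have pqF : [set p; q] \in edges (complete n).
  by rewrite in_sgraph_of inE cards2 neqPQ.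
apply: (implyP (forall_inP clE _ pqF)); apply/complete_bipartite_throughP.
exists P, Q, p, q; split=> // p' q' p'P q'Q.
rewrite in_sgraph_of cards2 neqPQ // andbT in_setU1.
by case: (eqVneq (p', q') (p, q)) => [[-> ->]|/PQ->]; rewrite ?eqxx ?orbT.
Qed.

Definition base_graph (X Z : {set 'I_n}) : {set {set 'I_n}} :=
  [set [set x; y] | x in X, y in ~: X] :|: [set e : {set 'I_n} | e \subset Z & #|e| == 2].

Variables X Z : {set 'I_n}.
Hypotheses (cX : #|X| = d) (cZ : #|Z| = d.+1) (sZ : Z \subset ~: X).

Lemma base_graph_sub : base_graph X Z \subset edges (complete n).
Proof.
apply/subsetP => e; rewrite in_sgraph_of in_setT /= !inE.
case/orP=> [/imset2P[x y xX yX ->]|/andP[]//]; rewrite cards2.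
by case: (eqVneq x y) yX => [<-|//]; rewrite inE xX.
Qed.

Lemma card_base_graph : #|base_graph X Z| = (d * (n - d) + 'C(d.+1, 2))%N.
Proof.
rewrite /base_graph cardsU disjoint_setI0 ?cards0 ?subn0.
  rewrite cards_draws cZ curry_imset2X card_in_imset; last first.
    move=> [x y] [x' y'] /setXP[/= xX yX] /setXP[/= x'X y'X] /setP eq_e.
    rewrite inE in yX; rewrite inE in y'X.
    have := eq_e x; rewrite !inE eqxx /= => /esym/predU1P[->|/eqP xy'].
      have := eq_e y; rewrite !inE eqxx orbT => /esym/predU1P[yx'|/eqP-> //].
      by rewrite yx' x'X in yX.
    by rewrite -xy' xX in y'X.
  by rewrite cardsX cX; congr (_ * _ + _)%N; rewrite cardsCs setCK card_ord cX.
rewrite disjoint_subset; apply/subsetP => _ /imset2P[x y xX _ ->].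
rewrite !inE negb_and; apply/orP; left; apply/negP => /subsetP/(_ x (set21 _ _)).
by move/(subsetP sZ); rewrite inE xX.
Qed.

Lemma base_graph_percolates :
  percolates (complete n) (complete_bipartite d.+1 d.+1) (base_graph X Z).
Proof.
move=> E clE sE; move: (sZ); set Y := ~: X => sZY.
have cY : #|Y| = (n - d)%N by rewrite cardsCs setCK card_ord cX.
have XY x y : x \in X -> y \in Y -> [set x; y] \in E.
  move=> xX yY; apply: (subsetP sE); rewrite inE; apply/orP; left.
  exact: imset2_f.
have ZZ z z' : z \in Z -> z' \in Z -> z != z' -> [set z; z'] \in E.
  move=> zZ z'Z zz'; apply: (subsetP sE); rewrite !inE cards2 zz' andbT.
  apply/orP; right; apply/subsetP => w; rewrite !inE => /orP[] /eqP-> //.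
have notX y : y \in Y -> y \notin X by rewrite inE.
(* In the copy with parts [y |: X] and [w |: N], only the edge from [y] to [w] can be missing. *)
have extend N y w : N \subset Y -> #|N| = d -> y \in Y -> y \notin N ->
    (forall v, v \in N -> [set y; v] \in E) -> w \in Y -> w != y ->
  [set y; w] \in E.
  move=> sN cN yY yN yNE wY wy; have [/yNE//|wN] := boolP (w \in N).
  apply: (sat_closed_edge (P := y |: X) (Q := w |: N)) clE _ _ _ _ _ _.
  - by rewrite cardsU1 notX // cX.
  - by rewrite cardsU1 wN cN.
  - rewrite disjoint_subset; apply/subsetP => v; rewrite !inE.
    case/predU1P=> [->|vX]; first by rewrite eq_sym negb_or wy.
    apply/norP; split; first by apply: contraTneq vX => ->; apply: notX.
    by apply: contraL vX => /(subsetP sN)/notX.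
  - exact: setU11.
  - exact: setU11.
  move=> p q; rewrite !inE xpair_eqE.
  case/predU1P=> [->|pX]; case/predU1P=> [->|qN]; rewrite ?eqxx // => _.
  - exact: yNE.
  - exact: XY.
  - by apply: XY => //; apply: (subsetP sN).
(* The [d] neighbours of [z] are the rest of the clique on [Z]. *)
have ZY z w : z \in Z -> w \in Y -> w != z -> [set z; w] \in E.
  move=> zZ; apply: (@extend (Z :\ z)).
  - exact: subset_trans (subD1set _ _) sZY.
  - by have := cardsD1 z Z; rewrite zZ cZ => -[].
  - exact: (subsetP sZY).
  - by rewrite !inE eqxx.
  by move=> v; rewrite !inE => /andP[vz vZ]; apply: ZZ => //; rewrite eq_sym.
(* Outside [Z], [y] is now adjacent to all of [Z], from which [d] vertices are taken. *)
have YY y w : y \in Y -> w \in Y -> w != y -> [set y; w] \in E.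
  move=> yY; have [yZ|yZ] := boolP (y \in Z); first exact: ZY.
  have [|N sN cN] := @card_subset_exists _ d Z; first by rewrite cZ.
  apply: (@extend N) => //; first exact: subset_trans sN sZY.
    by apply: contra yZ; apply: (subsetP sN).
  move=> v /(subsetP sN) vZ; rewrite setUC; apply: ZY => //.
  by apply: contraNneq yZ => ->.
(* The copy has parts [x |: B] and [x' |: C], with [B] and [C] disjoint in [Y]; there is room
   because [3 * d <= n] gives [2 * d <= #|Y|]. *)
have XX x x' : x \in X -> x' \in X -> x != x' -> [set x; x'] \in E.
  move=> xX x'X xx'.
  have [|B sB cB] := @card_subset_exists _ d Y; first by rewrite cY; lia.
  have [|C sC cC] := @card_subset_exists _ d (Y :\: B).
    by rewrite cardsDS // cY cB; lia.
  have BY b : b \in B -> b \in Y by apply: (subsetP sB).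
  have CY c : c \in C -> c \in Y by move/(subsetP sC); rewrite inE => /andP[].
  have CB c : c \in C -> c \notin B by move/(subsetP sC); rewrite inE => /andP[].
  apply: (sat_closed_edge (P := x |: B) (Q := x' |: C)) clE _ _ _ _ _ _.
  - by rewrite cardsU1 cB; case: (boolP (x \in B)) => // /BY/notX; rewrite xX.
  - by rewrite cardsU1 cC; case: (boolP (x' \in C)) => // /CY/notX; rewrite x'X.
  - rewrite disjoint_subset; apply/subsetP => v; rewrite !inE.
    case/predU1P=> [->|vB]; apply/norP; split=> //.
    + by apply: contraL xX => /CY/notX.
    + by apply: contraTneq x'X => <-; apply/notX/BY.
    by apply: contraL vB => /CB.
  - exact: setU11.
  - exact: setU11.
  move=> p q; rewrite !inE xpair_eqE.
  case/predU1P=> [->|pB]; case/predU1P=> [->|qC]; rewrite ?eqxx // => _.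
  - by apply: XY => //; apply: CY.
  - by rewrite setUC; apply: XY => //; apply: BY.
  - by apply: YY (BY _ pB) (CY _ qC) _; apply: contraTneq pB => <-; apply: CB.
apply/subsetP => e; rewrite in_sgraph_of => /andP[_ /cards2P[u [v [uv ->]]]].
have [uX|uX] := boolP (u \in X); have [vX|vX] := boolP (v \in X).
- exact: XX.
- by apply: XY; rewrite ?inE.
- by rewrite setUC; apply: XY; rewrite ?inE.
- by apply: YY; rewrite ?inE // eq_sym.
Qed.

End UpperBound.

(** * The exact value *)

Lemma wsat_complete_bipartite (n d : nat) : (0 < d)%N -> (3 * d <= n)%N ->
  (wsat (complete n) (complete_bipartite d.+1 d.+1) + 'C(d, 2) = d * n)%N.
Proof.
move=> d_gt0 hn.
have [|X _ cX] := @card_subset_exists _ d [set: 'I_n].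
  by rewrite cardsT card_ord; lia.
have [|Z sZ cZ] := @card_subset_exists _ d.+1 (~: X).
  by rewrite cardsCs setCK card_ord cX; lia.
have cA := card_base_graph cX cZ sZ.
(* This identity turns the size [d * (n - d) + 'C(d.+1, 2)] of the construction into the lower
   bound. *)
have sum_bin : ('C(d.+1, 2) + 'C(d, 2) = d * d)%N.
  rewrite binS bin1; have := mul_bin_diag d 1; rewrite bin1.
  by case: (d) d_gt0 => // k _ /=; nia.
have cA' : (#|base_graph X Z| + 'C(d, 2) = d * n)%N by rewrite cA; nia.
rewrite (@wsat_eq _ _ _ _ (base_graph X Z)) //.
- apply/set0Pn; exists [set inl ord0; inr ord0].
  by rewrite edges_complete_bipartite; apply: imset2_f.
- exact: base_graph_sub.
- exact: base_graph_percolates.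
(* The vertex numbers serve as nodes; [0 < d] makes [3 * d <= n] imply the strict [2 * d < n]. *)
move=> B _ percB; have injx : injective (fun u : 'I_n => (u : nat)%:R : rat).
  by move=> u v /eqP; rewrite Num.Theory.eqr_nat => /eqP/val_inj.
by have := percolates_lower_bound injx _ percB; lia.
Qed.

Theorem theorem2 (t n : nat) (ht : (2 <= t)%N) (hn : (3 * t - 3 <= n)%N) :
  (wsat (complete n) (complete_bipartite t t))%:R =
    (t%:R - 1) * (n%:R + 1 - t%:R / 2) :> rat.
Proof.
case: t ht hn => // d ht hn.
have wE : (wsat (complete n) (complete_bipartite d.+1 d.+1) + 'C(d, 2) = d * n)%N.
  by apply: wsat_complete_bipartite; lia.
(* A form without division or subtraction, which casts to [rat] termwise. *)
have binE : (2 * 'C(d, 2) + d = d * d)%N.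
  by rewrite -(mul_bin_diag d 1) bin1; case: (d) => // k /=; nia.
move: (congr1 (fun k : nat => k%:R : rat) wE) (congr1 (fun k : nat => k%:R : rat) binE).
rewrite !natrD !natrM => {}wE {}binE.
apply: (addIr 'C(d, 2)%:R); rewrite wE.
have -> : 'C(d, 2)%:R = (d%:R * d%:R - d%:R) / 2 :> rat by rewrite -binE; field.
by rewrite -[d.+1]addn1 natrD; field.
Qed.
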